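(* Let $E$ be a locally convex space such that $(E,w)$ is linearly Eberlein-Grothendieck. If there is a linear continuous quotient mapping $\pi$ from $E$ onto a locally convex space $F$, then $(F,w)$ is also linearly Eberlein-Grothendieck.
   Context: All topological spaces are assumed to be Tychonoff (in particular locally convex spaces are Hausdorff) and all vector spaces are over $\mathbb{R}$. For a locally convex space $E$, $(E,w)$ denotes $E$ with its weak topology $w=\sigma(E,E^{\ast})$, where $E^{\ast}$ is the space of continuous linear functionals on $E$. $C_p(K)$ is the space of continuous real-valued functions on $K$ with the topology of pointwise convergence. A locally convex space $H$ is linearly Eberlein-Grothendieck if $H$ is linearly isomorphic (i.e. linearly homeomorphic) to a linear subspace of $C_p(K)$ for some compact space $K$. A linear continuous quotient mapping is a continuous open linear surjection. *)

(* Defs.v *)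
From HB Require Import structures.
From mathcomp Require Import all_boot all_order all_algebra.
From mathcomp Require Import all_classical all_reals all_analysis.

Set Implicit Arguments.
Unset Strict Implicit.
Unset Printing Implicit Defensive.

Import Order.TTheory GRing.Theory Num.Theory.
Import numFieldNormedType.Exports.

Local Open Scope classical_set_scope.
Local Open Scope ring_scope.

Section WeakTopology.
Context {R : realType}.

Definition continuous_dual (E : tvsType R) : Type :=
  {f : {linear E -> R^o} | continuous f}.

(* A copy of the vector space E, to carry the topology sigma(E, E^* ). *)
Definition weak (E : tvsType R) : Type := E.

HB.instance Definition _ (E : tvsType R) := GRing.Lmodule.on (weak E).

HB.instance Definition _ (E : tvsType R) := Topological.copy (weak E)
  (sup_topology (fun f : continuous_dual E =>
     Topological.class (initial_topology (sval f : E -> R^o)))).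

End WeakTopology.

Section Cp.
Context {R : realType} (K : topologicalType).

Definition Cp : Type := continuousType K R^o.

HB.instance Definition _ := Choice.on Cp.

HB.instance Definition _ := Topological.copy Cp
  (initial_topology (fun f : Cp => (f : K -> R^o) : {ptws K -> R^o})).

Fact Cp_opp_subproof (f : Cp) : continuous (fun x => - f x).
Proof. by move=> x; apply: cvgN; exact: cts_fun. Qed.

Fact Cp_add_subproof (f g : Cp) : continuous (fun x => f x + g x).
Proof. by move=> x; apply: cvgD; exact: cts_fun. Qed.

Fact Cp_scale_subproof (a : R) (f : Cp) : continuous (fun x => a *: f x).
Proof. by move=> x; apply: cvgZr; exact: cts_fun. Qed.

Definition Cp_zero : Cp := (cst 0 : K -> R^o).
Definition Cp_opp (f : Cp) : Cp := mkcts (@Cp_opp_subproof f).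
Definition Cp_add (f g : Cp) : Cp := mkcts (@Cp_add_subproof f g).
Definition Cp_scale (a : R) (f : Cp) : Cp := mkcts (@Cp_scale_subproof a f).

Fact Cp_addA : associative Cp_add.
Proof. by move=> f g h; apply/continuousEP => x; exact: addrA. Qed.
Fact Cp_addC : commutative Cp_add.
Proof. by move=> f g; apply/continuousEP => x; exact: addrC. Qed.
Fact Cp_add0 : left_id Cp_zero Cp_add.
Proof. by move=> f; apply/continuousEP => x; exact: add0r. Qed.
Fact Cp_addN : left_inverse Cp_zero Cp_opp Cp_add.
Proof. by move=> f; apply/continuousEP => x; exact: addNr. Qed.

HB.instance Definition _ :=
  GRing.isZmodule.Build Cp Cp_addA Cp_addC Cp_add0 Cp_addN.

Fact Cp_scaleA a b (f : Cp) : Cp_scale a (Cp_scale b f) = Cp_scale (a * b) f.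
Proof. by apply/continuousEP => x; exact: scalerA. Qed.
Fact Cp_scale1 : left_id 1 Cp_scale.
Proof. by move=> f; apply/continuousEP => x; exact: scale1r. Qed.
Fact Cp_scaleDr : right_distributive Cp_scale +%R.
Proof. by move=> a f g; apply/continuousEP => x; exact: scalerDr. Qed.
Fact Cp_scaleDl (f : Cp) : {morph Cp_scale^~ f : a b / a + b}.
Proof. by move=> a b; apply/continuousEP => x; exact: scalerDl. Qed.

HB.instance Definition _ := GRing.Zmodule_isLmodule.Build R Cp
  Cp_scaleA Cp_scale1 Cp_scaleDr Cp_scaleDl.

End Cp.

Arguments Cp : clear implicits.

Section Definitions.
Context {R : realType}.

Definition linear_subspace (V : lmodType R) (L : set V) :=
  L 0 /\ forall (a : R) u v, L u -> L v -> L (a *: u + v).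

(* g is the inverse homeomorphism; only its values on L matter. *)
Definition linearly_homeomorphic_onto (H V : preTopologicalLmodType R)
    (L : set V) :=
  exists (f : {linear H -> V}) (g : V -> H),
    [/\ cancel f g, range f = L, continuous f & {within L, continuous g}].

Definition linearly_Eberlein_Grothendieck (H : preTopologicalLmodType R) :=
  exists K : topologicalType,
    [/\ compact [set: K], hausdorff_space K &
     exists2 L : set (Cp R K),
       linear_subspace L & linearly_homeomorphic_onto H L].

Definition linear_quotient_map (E F : tvsType R) (p : {linear E -> F}) :=
  [/\ continuous p, forall U : set E, open U -> open (p @` U)
    & range p = [set: F]].

End Definitions.

(* Main.v *)
Require Import Defs.
From HB Require Import structures.
From mathcomp Require Import all_boot all_order all_algebra.
From mathcomp Require Import all_classical all_reals all_analysis.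
From mathcomp Require Import ring lra.

Set Implicit Arguments.
Unset Strict Implicit.
Unset Printing Implicit Defensive.

Import Order.TTheory GRing.Theory Num.Theory.
Import numFieldNormedType.Exports.

Local Open Scope classical_set_scope.
Local Open Scope ring_scope.

(** Write E' for the space of continuous linear functionals on E, with the
    topology of pointwise convergence on E. The proof rests on a dual
    description of the property, valid for Hausdorff E:

      (E, w) embeds linearly in some C_p(K) with K compact if and only if E'
      contains a compact set A with E' = { t psi | t real, psi in A }.

    Existence of A ([weak_LEG_dual_generator]). An embedding T of (E, w) in
    C_p(K) yields the functionals phi x := (T _) x, which depend continuously
    on x in K. A functional f in E' is continuous for the topology induced by
    T, hence bounded near 0 by finitely many phi x_i; being linear it vanishes
    on the intersection of their kernels, so it is a linear combination of
    them. The combinations of n terms with coefficients in [-1, 1] form a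
    compact set B_n bounded by n M_e at each e; after multiplication by
    (n + 1)^-2 these sets shrink to 0, and therefore their union A is compact.

    Passage to the quotient ([dual_generator_quotient]). As p is open and onto,
    F' is the set of those functionals in E' that vanish on ker p, which is a
    closed condition. The part of A that satisfies it is compact, and it still
    contains a nonzero multiple of every nonzero functional in F', since such
    a multiple vanishes on ker p when the functional does. This is why A is
    asked to generate E' by scaling: a compact set whose linear span is E' may
    have no nonzero element in F'.

    Existence of an embedding ([dual_generator_weak_LEG]). Evaluation sends
    (F, w) to C_p(A). Every functional in F' is a multiple of an evaluation at
    a point of A, so the map is a homeomorphism onto its image as soon as it is
    injective, that is, as soon as F' separates the points of F. This last
    point is the Hahn-Banach theorem ([continuous_dual_separates]): the gauge
    of a convex neighbourhood of 0 that misses y is sublinear, and a linear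
    functional below the gauge that agrees with it at y is continuous and
    nonzero at y. *)

(** * The Hahn-Banach theorem for sublinear functionals *)

Section HahnBanach.
Context {R : realType} {V : lmodType R}.
Implicit Types (p q : V -> R) (x y : V).

Definition sublinear q :=
  (forall (a : R) x, 0 < a -> q (a *: x) <= a * q x) /\
  (forall x y, q (x + y) <= q x + q y).

Lemma sublinearZ q a x : sublinear q -> 0 < a -> q (a *: x) = a * q x.
Proof.
move=> [qZ _] a0; apply/eqP; rewrite eq_le qZ//=.
have := qZ a^-1 (a *: x); rewrite scalerA mulVf ?gt_eqF// scale1r invr_gt0.
by move=> /(_ a0); rewrite -ler_pdivlMl ?invr_gt0// invrK.
Qed.

Lemma sublinear0 q : sublinear q -> q 0 = 0.
Proof.
move=> sq; have := sublinearZ 0 sq (ltr0n R 2 : 0 < 2%:R); rewrite scaler0; lra.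
Qed.

Lemma sublinearZ_ge0 q a x : sublinear q -> 0 <= a -> q (a *: x) = a * q x.
Proof.
move=> sq; rewrite le_eqVlt => /predU1P[<-|]; last exact: sublinearZ.
by rewrite scale0r mul0r sublinear0.
Qed.

Lemma sublinear_geN q x : sublinear q -> - q (- x) <= q x.
Proof.
move=> sq; have := sq.2 x (- x); rewrite subrr sublinear0//; lra.
Qed.

Let straighten_set q y x :=
  [set q (x + t *: y) - t * q y | t in [set t : R | 0 <= t]].

(** The largest sublinear functional below [q] whose value at [- y] is at most
    [- q y]. If it equals [q], then [q (x + y) = q x + q y] for all [x]. *)
Definition straighten q y x := inf (straighten_set q y x).

Let has_lbound_straighten q y x : sublinear q ->
  has_lbound (straighten_set q y x).
Proof.
move=> sq; exists (- q (- x)) => _ [t /= t0 <-].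
rewrite -(sublinearZ_ge0 y sq t0).
have := sq.2 (x + t *: y) (- x); rewrite addrAC subrr add0r; lra.
Qed.

Lemma straighten_le q y x t : sublinear q -> 0 <= t ->
  straighten q y x <= q (x + t *: y) - t * q y.
Proof.
by move=> sq t0; apply: ge_inf; [exact: has_lbound_straighten|exists t].
Qed.

Lemma le_straighten q y x (c : R) :
  (forall t : R, 0 <= t -> c <= q (x + t *: y) - t * q y) ->
  c <= straighten q y x.
Proof.
move=> h; apply: lb_le_inf; first by exists (q (x + 0 *: y) - 0 * q y), 0 => /=.
by move=> _ [t t0 <-]; exact: h.
Qed.

Lemma sublinear_straighten q y : sublinear q -> sublinear (straighten q y).
Proof.
move=> sq; split=> [a x a0|x z].
  rewrite -ler_pdivrMl//; apply: le_straighten => t t0.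
  rewrite ler_pdivrMl//.
  apply: (le_trans (straighten_le (t := a * t) _ _ sq _)); first nra.
  by rewrite -scalerA -scalerDr (sublinearZ _ sq a0) mulrBr mulrA.
rewrite -lerBlDr; apply: le_straighten => t t0.
rewrite lerBlDl -lerBlDr; apply: le_straighten => s s0.
have := straighten_le y (x + z) sq (addr_ge0 t0 s0).
have := sq.2 (x + t *: y) (z + s *: y).
rewrite (addrACA x) -scalerDl; lra.
Qed.

Lemma straighten_min q y x : sublinear q -> straighten q y x <= q x.
Proof.
move=> sq; apply: le_trans (straighten_le y x sq (lexx 0)) _.
by rewrite scale0r addr0 mul0r subr0.
Qed.

Lemma straightenN q y : sublinear q -> straighten q y (- y) <= - q y.
Proof.
move=> sq; apply: le_trans (straighten_le y (- y) sq ler01) _.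
by rewrite scale1r addNr sublinear0// mul1r sub0r.
Qed.

(** Zorn's lemma applies because [- q (- x)] bounds from below the values at
    [x] of all sublinear functionals below [q]: a chain has a pointwise infimum,
    which is again sublinear. *)
Lemma minimal_sublinear q : sublinear q -> exists p,
  [/\ sublinear p, forall x, p x <= q x &
      forall r, sublinear r -> (forall x, r x <= p x) -> r = p].
Proof.
move=> sq.
pose T := {p | sublinear p /\ forall x, p x <= q x}.
pose q0 : T := exist _ q (conj sq (fun x => lexx (q x))).
pose leT (s t : T) := `[< forall x, sval t x <= sval s x >].
have [||A totA|[p [sp pq]] pmax] := @ZL_preorder T q0 leT.
- by move=> t; apply/asboolP.
- move=> r s t /asboolP rs /asboolP st; apply/asboolP => x.
  exact: le_trans (st x) (rs x).
- have [->|/set0P[a Aa]] := eqVneq A set0; first by exists q0.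
  pose S x := [set sval s x | s in A].
  pose m x := inf (S x).
  have lbS x : has_lbound (S x).
    exists (- q (- x)) => _ [s As <-].
    apply: le_trans (sublinear_geN x (svalP s).1).
    by rewrite lerN2 (svalP s).2.
  have mle s x : A s -> m x <= sval s x.
    by move=> As; apply: ge_inf => //; exists s.
  have lem x c : (forall s, A s -> c <= sval s x) -> c <= m x.
    move=> h; apply: lb_le_inf; first by exists (sval a x), a.
    by move=> _ [s As <-]; exact: h.
  have sm : sublinear m.
    split=> [b x b0|x y].
      rewrite -ler_pdivrMl//; apply: (lem x) => s As.
      by rewrite ler_pdivrMl// -(sublinearZ _ (svalP s).1 b0) mle.
    rewrite -lerBlDr; apply: (lem x) => s As.
    rewrite lerBlDl -lerBlDr; apply: (lem y) => t At.
    (* of two members of the chain, the smaller one bounds m (x + y) *)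
    have [/asboolP st|/asboolP ts] := totA _ _ As At.
      have := mle _ (x + y) At; have := (svalP t).1.2 x y; have := st x; lra.
    have := mle _ (x + y) As; have := (svalP s).1.2 x y; have := ts y; lra.
  have mq x : m x <= q x by apply: le_trans (mle a x Aa) _; exact: (svalP a).2.
  exists (exist _ m (conj sm mq)) => s As; apply/asboolP => x; exact: mle.
exists p; split => // r sr rp.
have rq x : r x <= q x := le_trans (rp x) (pq x).
have /asboolP /= pr := pmax (exist _ r (conj sr rq)) (asboolT rp).
by apply/funext => x; apply/eqP; rewrite eq_le rp pr.
Qed.

(** A minimal sublinear functional [p] is linear, as [straighten p z] must equal
    [p] for each [z]. Starting below [straighten q y] instead of [q] forces the
    value [q y] at [y]. *)
Lemma hahn_banach_sublinear q y : sublinear q ->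
  exists f : {linear V -> R^o}, (forall x, f x <= q x) /\ f y = q y.
Proof.
move=> sq.
have [p [sp pq pmin]] := minimal_sublinear (sublinear_straighten y sq).
have pD x z : p (x + z) = p x + p z.
  apply/eqP; rewrite eq_le sp.2/=.
  have -> : p x = straighten p z x.
    by rewrite (pmin _ (sublinear_straighten z sp) (fun t => straighten_min z t sp)).
  have := straighten_le z x sp ler01; rewrite scale1r mul1r; lra.
have pN x : p (- x) = - p x.
  by have := pD x (- x); rewrite subrr sublinear0//; lra.
have pZ a x : p (a *: x) = a * p x.
  have [a0|a0] := leP 0 a; first exact: sublinearZ_ge0.
  rewrite -[a]opprK scaleNr pN (sublinearZ _ sp) ?oppr_gt0//; lra.
have plin : linear (p : V -> R^o).
  by move=> a x z; rewrite pD pZ.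
pose Lp := GRing.isLinear.Build R V R^o *:%R p plin.
pose f : {linear V -> R^o} := HB.pack (p : V -> R^o) Lp.
exists f; split=> [x|]; first exact: le_trans (pq x) (straighten_min y x sq).
apply/eqP; rewrite eq_le (le_trans (pq y) (straighten_min y y sq))/=.
have := le_trans (pq (- y)) (straightenN y sq); rewrite pN /=; lra.
Qed.

End HahnBanach.

(** * Gauges and separation of points *)

Section Gauge.
Context {R : realType} {V : tvsType R}.
Implicit Types (x y : V).

Lemma linear_continuous_at0 (f : {linear V -> R^o}) :
  (forall e : R, 0 < e -> \forall x \near (0 : V), `|f x| < e) ->
  continuous f.
Proof.
move=> f0 x; apply/cvgrPdist_lt => e /f0 /(nbhsT x).
by apply: filterS => _ [y fy <-]; rewrite linearD opprD addNKr normrN.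
Qed.

Context (U : set V) (convU : convex_set U) (U0 : nbhs (0 : V) U).

Lemma convex_setP (l : R) x y :
  0 <= l -> l <= 1 -> U x -> U y -> U (l *: x + (1 - l) *: y).
Proof.
move=> l0 l1 /mem_set Ux /mem_set Uy.
by have /set_mem := convU (Itv01 l0 l1) Ux Uy.
Qed.

Let gauge_set x := [set t : R | 0 < t /\ U (t^-1 *: x)].

Definition gauge x := inf (gauge_set x).

Let gauge_set_neq0 x : gauge_set x !=set0.
Proof.
have /= := @scale_continuous R V (0, x) U; rewrite scale0r => /(_ U0).
move=> [B /= [/nbhs_ballP[e /= e0 eB] Bx] BU].
exists (2 / e); split; first by rewrite divr_gt0.
rewrite invf_div; apply: (BU (e / 2, x)); split; last exact: nbhs_singleton.
apply: eB.
by rewrite /ball /= sub0r normrN gtr0_norm ?divr_gt0// ltr_pdivrMr//; lra.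
Qed.

Lemma gauge_le t x : 0 < t -> U (t^-1 *: x) -> gauge x <= t.
Proof.
by move=> t0 Ut; apply: ge_inf => //; exists 0 => s [/ltW].
Qed.

Lemma le_gauge c x :
  (forall t, 0 < t -> U (t^-1 *: x) -> c <= t) -> c <= gauge x.
Proof. by move=> h; apply: lb_le_inf => // t [t0 Ut]; exact: h. Qed.

Lemma sublinear_gauge : sublinear gauge.
Proof.
split=> [a x a0|x y].
  rewrite -ler_pdivrMl//; apply: le_gauge => t t0 Ut.
  rewrite ler_pdivrMl//; apply: gauge_le; first exact: mulr_gt0.
  by rewrite scalerA invfM -mulrA mulrC -mulrA divff ?gt_eqF// mulr1.
rewrite -lerBlDr; apply: le_gauge => t t0 Ut.
rewrite lerBlDl -lerBlDr; apply: le_gauge => s s0 Us.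
rewrite lerBlDl; apply: gauge_le; first exact: addr_gt0.
have ts0 : t + s != 0 by rewrite gt_eqF ?addr_gt0.
have -> : (t + s)^-1 *: (x + y) =
    (t / (t + s)) *: (t^-1 *: x) + (1 - t / (t + s)) *: (s^-1 *: y).
  rewrite scalerDr !scalerA; congr (_ *: _ + _ *: _); field; rewrite ?ts0 ?gt_eqF//.
apply: convex_setP => //; first by rewrite divr_ge0 ?addr_ge0 ?ltW.
by rewrite ler_pdivrMr ?addr_gt0// mul1r lerDl ltW.
Qed.

(** Scaling by a number below 1 keeps a point of [U] in [U], by convexity with
    0; so no [t < 1] is admissible in the infimum. *)
Lemma gauge_ge1 y : ~ U y -> 1 <= gauge y.
Proof.
move=> nUy; apply: le_gauge => t t0 Ut; rewrite leNgt; apply/negP => t1.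
apply: nUy; have := convex_setP (ltW t0) (ltW t1) Ut (nbhs_singleton U0).
by rewrite scaler0 addr0 scalerA divff ?gt_eqF// scale1r.
Qed.

(** The bound [f <= 1] on [U] becomes [`|f| <= 1] on the symmetric
    neighbourhood [U `&` - U], and linearity scales it down. *)
Lemma continuous_le_gauge (f : {linear V -> R^o}) :
  (forall x, f x <= gauge x) -> continuous f.
Proof.
move=> fg; apply: linear_continuous_at0 => e e0.
have bnd x : U (x : V) -> f x <= 1.
  move=> Ux; apply: le_trans (fg x) _; apply: gauge_le => //.
  by rewrite invr1 scale1r.
have e20 : e / 2 != 0 by rewrite gt_eqF ?divr_gt0.
have UN0 : nbhs (0 : V) (U `&` (-%R @` U)).
  by apply: filterI => //; exact: nbhs0N.
have V0 := nbhs0Z e20 UN0.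
apply: filterS V0 => _ [z [Uz [w Uw wz]] <-].
rewrite linearZ/= normrM gtr0_norm ?divr_gt0//.
have fz1 := bnd _ Uz.
have fw1 := bnd _ Uw; rewrite -wz linearN/= in fz1 *.
have : `|- f w| <= 1 by rewrite ler_norml; apply/andP; split; lra.
nra.
Qed.

End Gauge.

Lemma continuous_dual_separates (R : realType) (V : tvsType R) (y : V) :
  hausdorff_space V -> y != 0 ->
  exists f : {linear V -> R^o}, continuous f /\ f y != 0.
Proof.
move=> hV y0.
have [U0 [U0n nUy]] : exists U, nbhs (0 : V) U /\ ~ U y.
  apply: contrapT => H; move/eqP: y0; apply; apply/esym/hV => A B A0 By.
  exists y; split; last exact: nbhs_singleton.
  by apply: contrapT => nAy; apply: H; exists A.
have [B convB [oB /(_ 0 U0 U0n)[W [BW W0] WU]]] := @locally_convex R V.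
have nW : nbhs (0 : V) W by apply: open_nbhs_nbhs; split => //; exact: oB.
have cW := convB _ (mem_set BW).
have [f [fg fy]] := hahn_banach_sublinear y (sublinear_gauge cW nW).
exists f; split; first exact: (continuous_le_gauge nW fg).
rewrite fy gt_eqF// (lt_le_trans ltr01)//; apply: gauge_ge1 => // /WU.
exact: nUy.
Qed.

(** * Functionals determined by finitely many kernels *)

Lemma linear_scalarZ (R : realType) (E : lmodType R) (f : {linear E -> R^o})
    (a : R) x : f (a *: x) = a * f x.
Proof. exact: linearZ. Qed.

Section Kernels.
Context {R : realType} {E : lmodType R} {X : eqType}.

(** Induction on [s]. If [phi x] does not vanish at some [e0] where the other
    functionals of [s] do, subtracting a multiple of [phi x] from [f] reduces
    to these others; if there is no such [e0], they alone determine [f]. *)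
Lemma combination_of_vanishing (phi : X -> {linear E -> R^o}) (s : seq X)
    (f : {linear E -> R^o}) :
  (forall e, (forall x, x \in s -> phi x e = 0) -> f e = 0) ->
  exists l : seq (R * X), forall e, f e = \sum_(u <- l) u.1 * phi u.2 e.
Proof.
elim: s f => [|x s IH] f fs.
  by exists [::] => e; rewrite big_nil fs.
have [[e0 [e0s e0x]]|none] :=
    pselect (exists e, (forall z, z \in s -> phi z e = 0) /\ phi x e <> 0).
  pose c := f e0 / phi x e0.
  have [e es|l lE] := IH (f \- (c \*: phi x)).
    pose e1 := e - (phi x e / phi x e0) *: e0.
    have fe1 : f e1 = 0.
      apply: fs => z; rewrite /e1 linearB linear_scalarZ inE => /predU1P[->|zs].
        by rewrite divfK ?subrr//; exact/eqP.
      by rewrite (es z zs) (e0s z zs) mulr0 subrr.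
    by rewrite -fe1 /e1 linearB linear_scalarZ /c /=; rewrite /GRing.scale/=; ring.
  exists ((c, x) :: l) => e; rewrite big_cons -lE /=.
  by rewrite addrC subrK.
apply: IH => e es; apply: fs => z; rewrite inE => /predU1P[->|/es//].
by apply: contrapT => xe; apply: none; exists e.
Qed.

End Kernels.

(** * Compact unions and convergence in initial topologies *)

(** An ultrafilter on the union that contains none of the [A_ n] avoids
    finitely many of them at a time, so it converges to [a]. *)
Lemma compact_bigcup_shrinking (T : topologicalType) (A_ : nat -> set T) (a : T) :
  (forall n, compact (A_ n)) -> (\bigcup_n A_ n) a ->
  (forall U, nbhs a U -> \forall n \near \oo, A_ n `<=` U) ->
  compact (\bigcup_n A_ n).
Proof.
move=> cA Aa shrink; rewrite compact_ultra => F FU FA.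
have [[n Fn]|Fnone] := pselect (exists n, F (A_ n)).
  have := cA n; rewrite compact_ultra => /(_ F FU Fn)[p [Ap Fp]].
  by exists p; split => //; exists n.
exists a; split => // U /shrink[N _ NU]; rewrite nbhs_filterE.
have FC n : F (~` A_ n).
  by have [Fn|//] := in_ultra_setVsetC (A_ n) FU; case: Fnone; exists n.
have FN : F (\bigcap_(n in `I_N) ~` A_ n).
  have -> : (\bigcap_(n in `I_N) ~` A_ n) = \big[setI/setT]_(n < N) ~` A_ n.
    by rewrite bigcap_mkord.
  by elim/big_ind: _ => // [|B C]; [exact: filterT|exact: filterI].
apply: filterS (filterI FA FN) => x [[n _ Anx] Nx].
apply: (NU n) => //=; rewrite leqNgt; apply/negP => nN; exact: (Nx n).
Qed.

Lemma cvg_initial (S : choiceType) (T : topologicalType) (f : S -> T)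
    (F : set_system S) (s : S) : Filter F ->
  F --> (s : initial_topology f) <-> f @ F --> f s.
Proof.
move=> FF; split=> [Fs|fFs A [_ [[B oB <-] Bs BA]]].
  exact: cvg_trans (cvg_app f Fs) (@initial_continuous _ _ f s).
by apply: filterS BA _; apply: fFs; apply: open_nbhs_nbhs.
Qed.

Section WeakAndPointwise.
Context {R : realType}.

Lemma cvg_weak (E : tvsType R) (F : set_system (weak E)) (x : weak E) :
  Filter F ->
  F --> x <-> forall f : {linear E -> R^o}, continuous f -> f @ F --> f x.
Proof.
move=> FF; split=> [Fx f cf|Ff].
  apply/cvg_initial.
  exact: (iffLR (@cvg_sup _ _ _ F x FF) Fx (exist _ f cf)).
apply: (iffRL (@cvg_sup _ _ _ F x FF)) => -[f cf].
by apply: (iffRL (@cvg_initial _ _ _ F x FF)); exact: Ff.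
Qed.

Lemma cvg_Cp (K : topologicalType) (F : set_system (Cp R K)) (h : Cp R K) :
  Filter F ->
  F --> h <-> forall x, (fun g : Cp R K => g x) @ F --> h x.
Proof.
move=> FF; have := @cvg_initial (Cp R K) {ptws K -> R^o} (fun g => (g : K -> R^o)) F h FF.
move=> I; apply: (iff_trans I).
exact: (@pointwise_cvgP K R^o ((fun g : Cp R K => (g : K -> R^o)) @ F) h).
Qed.

End WeakAndPointwise.

(** * Generating the dual by scaling a compact set *)

Section DualGenerator.
Context {R : realType}.

(** Scalar multiples, rather than linear combinations, are what makes this
    condition pass to quotients. The zero functional is required because it may
    be the only element of [A] that vanishes on a given subspace. *)
Definition dual_generator (E : tvsType R) (A : set {ptws E -> R^o}) :=
  [/\ compact A, A (fun=> 0),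
   (forall psi, A psi ->
      exists2 f : {linear E -> R^o}, continuous f & psi = f) &
   (forall f : {linear E -> R^o}, continuous f ->
      exists t psi, A psi /\ forall e, f e = t * psi e)].

Section BoundedSums.
Context {E : Type} {K : topologicalType} (phi : K -> {ptws E -> R^o}).

(** Sums of [n] terms [c *: phi x] with [c] between -1 and 1, built by recursion
    so that each step is the continuous image of a product of compact sets. *)
Fixpoint bounded_sums n : set {ptws E -> R^o} :=
  if n is n'.+1 then
    [set (fun e => u.1 e + u.2.1 * phi u.2.2 e) |
      u in bounded_sums n' `*` ([set` `[-1, 1]] `*` [set: K])]
  else [set fun=> 0].

End BoundedSums.

Lemma continuous_ptws (X : topologicalType) (E : topologicalType)
    (h : X -> {ptws E -> R^o}) :
  (forall e, continuous (fun x => h x e : R^o)) -> continuous h.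
Proof.
by move=> ch x; apply/(@pointwise_cvgP E R^o (h @ x) (h x)) => e; exact: ch.
Qed.

Lemma continuous_eval (E : topologicalType) (e : E) :
  continuous (fun g : {ptws E -> R^o} => g e : R^o).
Proof.
move=> g.
exact: (iffLR (@pointwise_cvgP E R^o (nbhs g) g (nbhs_filter g)) (@cvg_id _ (nbhs g)) e).
Qed.

Definition scale_ptws (E : topologicalType) (c : R) (h : {ptws E -> R^o}) :
  {ptws E -> R^o} := fun e => c * h e.

Lemma continuous_scale_ptws (E : topologicalType) (c : R) :
  continuous (@scale_ptws E c).
Proof.
apply: continuous_ptws => e h.
have ck : (fun=> c : R^o) @ nbhs h --> (c : R^o) by exact: cvg_cst.
exact: cvgM ck (@continuous_eval E e h).
Qed.

Lemma compact_bounded_sums (E K : topologicalType) (phi : K -> {ptws E -> R^o}) n :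
  compact [set: K] -> continuous phi -> compact (bounded_sums phi n).
Proof.
move=> cK cphi; elim: n => [|n IH] /=; first exact: compact_set1.
pose D := ({ptws E -> R^o} * (R^o * K))%type.
pose step (u : D) : {ptws E -> R^o} := fun e => u.1 e + u.2.1 * phi u.2.2 e.
have cstep : continuous step.
  apply: continuous_ptws => e u.
  have c1 : (fun v : D => v.1 e) @ u --> u.1 e.
    exact: (cvg_comp (fst : D -> _) _ cvg_fst (@continuous_eval E e u.1)).
  have c2 : (fun v : D => v.2.1) @ u --> u.2.1.
    exact: (cvg_comp (snd : D -> _) _ cvg_snd cvg_fst).
  have c3 : (fun v : D => phi v.2.2 e) @ u --> phi u.2.2 e.
    have c31 : (fun v : D => v.2.2) @ u --> u.2.2.
      exact: (cvg_comp (snd : D -> _) _ cvg_snd cvg_snd).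
    have c32 := cvg_comp _ _ c31 (cphi u.2.2).
    exact: (cvg_comp _ _ c32 (@continuous_eval E e (phi u.2.2))).
  exact: cvgD c1 (cvgM c2 c3).
apply: (@continuous_compact D _ step); first exact: continuous_subspaceT.
apply: compact_setX => //; apply: compact_setX => //.
exact: segment_compact.
Qed.

Lemma le_bounded_sums (E : Type) (K : topologicalType)
    (phi : K -> {ptws E -> R^o}) n psi (e : E) (M : R) :
  (forall x, `|phi x e| <= M) -> bounded_sums phi n psi ->
  `|psi e| <= n%:R * M.
Proof.
move=> phiM; elim: n psi => [|n IH] psi /=.
  by move=> ->; rewrite normr0 mul0r.
move=> [[chi [c x]]/= [/IH chin [c1 _]] <-].
apply: le_trans (ler_normD _ _) _; rewrite -natr1 mulrDl mul1r.
apply: lerD => //; rewrite normrM -[leRHS]mul1r; apply: ler_pM => //.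
by move: c1; rewrite /= in_itv/= -ler_norml.
Qed.

Lemma bounded_sums_dual (E : tvsType R) (K : topologicalType)
    (phi : K -> {ptws E -> R^o}) n psi :
  (forall x, exists2 f : {linear E -> R^o}, continuous f & phi x = f) ->
  bounded_sums phi n psi ->
  exists2 f : {linear E -> R^o}, continuous f & psi = f.
Proof.
move=> phiE; elim: n psi => [|n IH] psi /=.
  by move=> ->; exists \0 => //; exact: cst_continuous.
move=> [[chi [c x]]/= [/IH[f cf ->] _] <-].
have [g cg ->] := phiE x.
exists (f \+ (c \*: g)) => // e.
by apply: cvgD; [exact: cf|apply: cvgM; [exact: cvg_cst|exact: cg]].
Qed.

Lemma bounded_sums_seq (E : Type) (K : topologicalType)
    (phi : K -> {ptws E -> R^o}) (l : seq (R * K)) :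
  (forall u, u \in l -> `|u.1| <= 1) ->
  bounded_sums phi (size l) (fun e => \sum_(u <- l) u.1 * phi u.2 e).
Proof.
elim: l => [|[c x] l IH] l1 /=.
  by apply/funext => e; rewrite big_nil.
exists ((fun e => \sum_(u <- l) u.1 * phi u.2 e), (c, x)) => /=.
  split; first by apply: IH => u ul; apply: l1; rewrite inE ul orbT.
  split => //=; rewrite in_itv/= -ler_norml.
  by apply: (l1 (c, x)); rewrite inE eqxx.
by apply/funext => e; rewrite big_cons/= addrC.
Qed.

(** Dividing a combination by a bound on its coefficients puts it in some
    [bounded_sums phi n], so every continuous functional is a multiple of an
    element of that set. The weights [(n + 1)^-2] then outweigh the growth
    [n * M] of these sets at a point, so that the union is compact. *)
Lemma dual_generator_of_combinations (E : tvsType R) (K : topologicalType)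
    (phi : K -> {ptws E -> R^o}) :
  compact [set: K] -> continuous phi ->
  (forall x, exists2 f : {linear E -> R^o}, continuous f & phi x = f) ->
  (forall f : {linear E -> R^o}, continuous f -> exists l : seq (R * K),
     forall e, f e = \sum_(u <- l) u.1 * phi u.2 e) ->
  exists A, dual_generator (E := E) A.
Proof.
move=> cK cphi phiE spanE.
pose w n : R := n.+1%:R ^- 2.
pose A_ n : set {ptws E -> R^o} :=
  [set scale_ptws (w n) psi | psi in bounded_sums phi n].
have A0 : (\bigcup_n A_ n) (fun=> 0).
  by exists 0%N => //; exists (fun=> 0) => //; apply/funext => e; exact: mulr0.
have phiM e : exists M : R, forall x, `|phi x e| <= M.
  have cphie : continuous (fun x => phi x e : R^o).
    move=> x; exact: (cvg_comp _ _ (cphi x) (@continuous_eval E e (phi x))).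
  have /compact_bounded[M [_ HM]] : compact [set (phi x e : R^o) | x in [set: K]].
    apply: continuous_compact => //; exact: continuous_subspaceT.
  exists (M + 1) => x; apply: (HM (M + 1)); last by exists x.
  by rewrite ltrDl.
exists (\bigcup_n A_ n); split => //.
- apply: (@compact_bigcup_shrinking {ptws E -> R^o} A_ (fun=> 0)) => //.
    move=> n; apply: (@continuous_compact {ptws E -> R^o} _ (scale_ptws (w n))).
      exact: continuous_subspaceT (@continuous_scale_ptws E (w n)).
    exact: compact_bounded_sums.
  (* the shrinking of the A_ n is the convergence of G, which can be checked
     at one point e at a time *)
  pose G : set_system {ptws E -> R^o} :=
    fun U => \forall n \near \oo, A_ n `<=` U.
  have FG : Filter G.
    split; first by apply: nearW.
      move=> P Q [N1 _ NP] [N2 _ NQ]; exists (maxn N1 N2) => // n /=.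
      by rewrite geq_max => /andP[/NP AP /NQ AQ] x Ax; split; [exact: AP|exact: AQ].
    by move=> P Q PQ [N _ NP]; exists N => // n /NP AP x /AP /PQ.
  suff : G --> ((fun=> 0) : {ptws E -> R^o}) by apply.
  apply/(@pointwise_cvgP E R^o G (fun=> 0)) => e.
  apply/cvgrPdist_lt => eps eps0.
  have [M HM] := phiM e.
  have near_n := nbhs_infty_gtr (M / eps).
  change (\forall n \near \oo, A_ n `<=` [set g | `|0 - g e| < eps]).
  near=> n => _ [psi psin <-] /=.
  rewrite sub0r normrN normrM gtr0_norm ?invr_gt0 ?exprn_gt0 ?ltr0n//.
  rewrite ltr_pdivrMl ?exprn_gt0 ?ltr0n//.
  apply: le_lt_trans (le_bounded_sums HM psin) _.
  have Mn : M < eps * n%:R by rewrite mulrC -ltr_pdivrMr//; near: n.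
  have n0 : (0 : R) <= n%:R by [].
  rewrite -natr1; nra.
- move=> psi [n _ [chi /(bounded_sums_dual phiE)[f cf ->] <-]].
  exists (w n \*: f) => // e; apply: cvgM; [exact: cvg_cst|exact: cf].
move=> f /spanE[l fl].
(* the summand 1 keeps s invertible when l is empty or has zero coefficients *)
pose s : R := 1 + \sum_(u <- l) `|u.1|.
have s0 : 0 < s by rewrite ltr_pwDl// sumr_ge0.
pose l' := [seq (s^-1 * u.1, u.2) | u <- l].
have l'1 u : u \in l' -> `|u.1| <= 1.
  move=> /mapP[v vl ->] /=; rewrite normrM gtr0_norm ?invr_gt0//.
  rewrite ler_pdivrMl// mulr1 /s (big_rem _ vl)/= addrCA lerDl.
  by rewrite addr_ge0// sumr_ge0.
have w0 : w (size l') != 0 by rewrite invr_neq0// expf_neq0.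
exists (s / w (size l')), (fun e => w (size l') * (\sum_(u <- l') u.1 * phi u.2 e)).
split.
  exists (size l') => //; exists (fun e => \sum_(u <- l') u.1 * phi u.2 e) => //.
  exact: bounded_sums_seq.
move=> e; rewrite mulrA divfK// fl big_map mulr_sumr; apply: eq_bigr => u _ /=.
by rewrite -mulrA mulVKf// gt_eqF.
Unshelve. all: by end_near. Qed.

End DualGenerator.

(** * From an embedding to a compact generator *)

Section Characterization.
Context {R : realType}.

Lemma continuous_Cp_eval (K : topologicalType) (x : K) :
  continuous (fun h : Cp R K => h x : R^o).
Proof. by move=> h; apply: (iffLR (@cvg_Cp R K (nbhs h) h _)); exact: cvg_id. Qed.

Lemma continuous_to_weak (E : tvsType R) : continuous (fun e : E => e : weak E).
Proof. by move=> e; apply/cvg_weak => f cf; exact: cf. Qed.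

(** Every continuous functional on [E] is a combination of the functionals
    [e |-> T e x], where [T] is an embedding of [weak E] in [Cp R K]. *)
Lemma weak_LEG_dual_generator (E : tvsType R) :
  linearly_Eberlein_Grothendieck (weak E) ->
  exists A, dual_generator (E := E) A.
Proof.
move=> [K [cK _ [L _ [T [g [Tg rangeT cT cg]]]]]].
pose phi (x : K) : {ptws E -> R^o} := fun e : E => T (e : weak E) x.
have phi_lin x : linear (phi x : E -> R^o).
  by move=> a u v; rewrite /phi linearP.
pose phiL x : {linear E -> R^o} :=
  HB.pack (phi x : E -> R^o) (GRing.isLinear.Build R E R^o *:%R (phi x) (phi_lin x)).
apply: (@dual_generator_of_combinations R E K phi) => //.
- by apply: continuous_ptws => e; exact: cts_fun.
- move=> x; exists (phiL x) => // e.
  have ce := cvg_comp _ _ (@continuous_to_weak E e) (cT e).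
  exact: (cvg_comp _ _ ce (@continuous_Cp_eval K x (T e))).
move=> f cf.
suff [s sf] : exists s : seq K,
    forall e, (forall x, x \in s -> phi x e = 0) -> f e = 0.
  exact: (@combination_of_vanishing R E K phiL s f).
(* The filter of sets containing all functions that vanish on some finite set
   converges to 0 in Cp; this yields a finite set s without handling a
   neighbourhood base of the product topology. *)
pose Z (s : seq K) : set (Cp R K) := [set h | forall x, x \in s -> h x = 0].
pose G : set_system (Cp R K) := fun W => exists s, Z s `<=` W.
have FG : Filter G.
  split; first by exists [::].
    move=> P Q [s sP] [t tQ]; exists (s ++ t) => h hst.
    by split; [apply: sP|apply: tQ] => x xs; apply: hst; rewrite mem_cat xs ?orbT.
  by move=> P Q PQ [s sP]; exists s => h /sP /PQ.
have G0 : G --> (0 : Cp R K).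
  apply/cvg_Cp => x W W0; exists [:: x] => h /(_ x (mem_head _ _)) h0.
  by rewrite /preimage /= h0; exact: nbhs_singleton W0.
have L0 : L 0 by rewrite -rangeT; exists 0 => //; rewrite linear0.
have g0 : g 0 = 0 by rewrite -[X in g X](linear0 T) Tg.
have fg0 : (fun h : Cp R K => f (g h)) @ within L (nbhs (0 : Cp R K)) --> (0 : R^o).
  have gc : g @ within L (nbhs (0 : Cp R K)) --> (0 : weak E).
    have /subspace_continuousP/(_ 0 L0) := cg.
    by rewrite -[in X in _ -> X]g0.
  have := iffLR (@cvg_weak R E _ _ _) gc f cf; rewrite linear0; exact.
have /G0[s sV] : nbhs (0 : Cp R K) [set h | L h -> `|f (g h)| < 1].
  exact: (iffLR (cvgr0Pnorm_lt (fun h : Cp R K => f (g h))) fg0 _ ltr01).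
exists s => e es.
(* the points on which phi x vanishes for x in s form a subspace, so all
   multiples of e are small under f *)
have small (r : R) : `|r * f e| < 1.
  rewrite -linear_scalarZ -[X in f X]Tg; apply: sV; last first.
    by rewrite -rangeT; exists (r *: e : weak E).
  move=> x xs; rewrite linearZ; have := es x xs; rewrite /phi /= => ex.
  have : (r *: T (e : weak E)) x = r * T (e : weak E) x by [].
  by move=> ->; rewrite ex mulr0.
apply/eqP; apply: contrapT => /negP fe0.
have := small (f e)^-1; rewrite mulVf// normr1 ltxx; exact.
Qed.

End Characterization.

(** * Passage to the quotient *)

Section Quotient.
Context {R : realType}.

Lemma closed_annihilator (E : tvsType R) (Z : set E) :
  closed [set psi : {ptws E -> R^o} | forall e, Z e -> psi e = 0].
Proof.
have -> : [set psi : {ptws E -> R^o} | forall e, Z e -> psi e = 0] =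
    \bigcap_(e in Z) ((fun psi : {ptws E -> R^o} => psi e : R^o) @^-1` [set 0]).
  by apply/seteqP; split => psi h e Ze; exact: h.
apply: closed_bigI => e _; apply: preimage_closed.
  by move=> psi _; exact: (@continuous_eval R E e).
exact: closed_eq.
Qed.

(** Functionals that vanish on [ker p] are transported to [F] by composition
    with a set-theoretic section [s] of [p]; this restriction map is pointwise
    continuous although [s] need not be continuous. *)
Lemma dual_generator_quotient (E F : tvsType R) (p : {linear E -> F}) A :
  linear_quotient_map p -> dual_generator (E := E) A ->
  exists B, dual_generator (E := F) B.
Proof.
move=> [cp op rp] [cA A0 Adual Agen].
have /choice[s ps] : forall y, exists e, p e = y.
  by move=> y; have [e _ <-] : range p y; [rewrite rp|exists e].
pose N : set {ptws E -> R^o} := [set psi | forall e, p e = 0 -> psi e = 0].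
pose r (psi : {ptws E -> R^o}) : {ptws F -> R^o} := fun y => psi (s y).
have cr : continuous r.
  by apply: continuous_ptws => y; exact: (@continuous_eval R E (s y)).
have eqN psi e e' : N psi -> (exists f : {linear E -> R^o}, psi = f) ->
    p e = p e' -> psi e = psi e'.
  move=> Npsi [f psif] pe; apply/eqP; rewrite -subr_eq0 psif -linearB -psif.
  by apply/eqP/Npsi; rewrite linearB pe subrr.
exists (r @` (A `&` N)); split.
- apply: (@continuous_compact _ _ r); first exact: continuous_subspaceT.
  exact: compact_closedI cA (@closed_annihilator E (fun e => p e = 0)).
- by exists (fun=> 0).
- move=> _ [psi [/[dup] Apsi /Adual[f cf psif] Npsi] <-].
  have fp e : psi (s (p e)) = psi e by apply: eqN => //; exists f.
  have rlin : linear (r psi : F -> R^o).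
    move=> a u v; rewrite /r -{1}(ps u) -{1}(ps v) -linearP fp psif.
    exact: linearP.
  exists (HB.pack (r psi : F -> R^o) (GRing.isLinear.Build R F R^o *:%R (r psi) rlin)
    : {linear F -> R^o}) => //.
  apply/continuousP => O oO /=.
  (* this rewriting uses that p is onto; openness of p then concludes *)
  have -> : (r psi : F -> R^o) @^-1` O = p @` (f @^-1` O).
    apply/seteqP; split => [y Oy|_ [e Oe <-]].
      by exists (s y); [rewrite /= -psif|exact: ps].
    by rewrite /= /r fp psif.
  by apply: op; apply: open_comp => // x _; exact: cf.
move=> f cf.
pose fp : {linear E -> R^o} := f \o p.
have cfp : continuous fp by move=> e; apply: continuous_comp; [exact: cp|exact: cf].
have [t [psi [Apsi fpE]]] := Agen fp cfp.
have fE y : f y = t * psi (s y) by rewrite -fpE /= ps.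
have [t0|t0] := eqVneq t 0.
  exists 0, (fun=> 0); split; first by exists (fun=> 0).
  by move=> y; rewrite fE t0 !mul0r.
exists t, (r psi); split=> //; exists psi => //; split=> // e pe.
apply: (mulfI t0); rewrite -fpE mulr0 /= pe; exact: linear0.
Qed.

End Quotient.

(** * From a compact generator to an embedding *)

Section Converse.

Section Subspace.
Context {X : topologicalType} (A : set X).

Definition subtype_space : Type := initial_topology (val : A -> X).

HB.instance Definition _ := Topological.on subtype_space.

Lemma compact_subtype_space : compact A -> compact [set: subtype_space].
Proof.
move=> cA F FF FT.
have GU : ProperFilter ((val : A -> X) @ F) by exact: fmap_proper_filter.
have FA : ((val : A -> X) @ F) A.
  have valA : [set: subtype_space] `<=` val @^-1` A by move=> a _; exact: set_valP a.
  exact: filterS valA FT.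
have [x [Ax clx]] := cA _ GU FA.
pose a : subtype_space := exist _ x (mem_set Ax).
exists a; split => //.
move=> B C FB [_ [[W oW <-] Wa WC]].
have FvB : ((val : A -> X) @ F) ((val : A -> X) @` B).
  have subB : B `<=` val @^-1` ((val : A -> X) @` B) by move=> b Bb; exists b.
  exact: filterS subB FB.
have [y [[b Bb <-] Wb]] := clx _ _ FvB (open_nbhs_nbhs (conj oW Wa)).
by exists b; split => //; exact: WC.
Qed.

Lemma hausdorff_subtype_space : hausdorff_space X -> hausdorff_space subtype_space.
Proof.
move=> hX a b ab; apply: val_inj; apply: hX => U V nU nV.
have cval := @initial_continuous A X val.
have [c [Uc Vc]] := ab _ _ (cval a U nU) (cval b V nV).
by exists (val c).
Qed.

End Subspace.

(** The embedding is evaluation, [y |-> (psi |-> psi y)] with [psi] in [A]. Its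
    inverse is weakly continuous since each continuous functional is a multiple
    of a coordinate; injectivity is where local convexity and Hausdorffness of
    [F] come in. *)
Lemma dual_generator_weak_LEG (R : realType) (F : tvsType R) A :
  hausdorff_space F -> dual_generator (E := F) A ->
  linearly_Eberlein_Grothendieck (weak F).
Proof.
move=> hF [cA A0 Adual Agen].
pose K : topologicalType := subtype_space A.
have Kdual (k : K) : exists2 f : {linear F -> R^o}, continuous f & val k = f.
  exact/Adual/set_valP.
exists K; split.
- exact: compact_subtype_space.
- apply: hausdorff_subtype_space; apply: hausdorff_product => _.
  exact: Rhausdorff.
have cT (y : weak F) : continuous (fun k : K => val k y : R^o).
  move=> k; have ck := @initial_continuous A {ptws F -> R^o} val k.
  exact: (cvg_comp _ _ ck (@continuous_eval R F y (val k))).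
pose T (y : weak F) : Cp R K := mkcts (cT y).
have Tlin : linear T.
  move=> a u v; apply/continuousEP => k.
  by have [f _ kf] := Kdual k; rewrite /= /mkcts kf linearP -kf.
pose TL : {linear weak F -> Cp R K} :=
  HB.pack T (GRing.isLinear.Build R (weak F) (Cp R K) *:%R T Tlin).
have Tinj : injective T.
  move=> u v uv; apply/eqP; rewrite -subr_eq0; apply/eqP; apply: contrapT => /eqP uv0.
  have [f [cf]] := continuous_dual_separates hF uv0.
  have [t [psi [Apsi fE]]] := Agen f cf.
  have := congr1 (fun h : Cp R K => h (exist _ psi (mem_set Apsi))) uv.
  by rewrite /= /mkcts /= => psiuv; rewrite linearB/= !fE psiuv subrr eqxx.
pose g (h : Cp R K) : weak F := xget 0 [set y | T y = h].
have Tg : cancel T g.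
  by move=> y; apply: Tinj; exact: (xgetPex 0 (ex_intro (fun z => T z = T y) y erefl)).
exists (range T).
  split; first by exists 0 => //; exact: (linear0 TL).
  move=> a _ _ [u _ <-] [v _ <-]; exists (a *: u + v) => //; exact: Tlin.
exists TL, g; split => //.
- move=> y.
  have FT : Filter (T @ nbhs (y : weak F)) by exact: fmap_filter.
  apply: (iffRL (@cvg_Cp R K (T @ nbhs (y : weak F)) (T y) FT)) => k.
  have [f cf kf] := Kdual k.
  have fy := iffLR (@cvg_weak R F (nbhs (y : weak F)) y _) cvg_id f cf.
  change ((fun z : weak F => (val k : {ptws F -> R^o}) z : R^o) @ nbhs (y : weak F)
    --> ((val k : {ptws F -> R^o}) y : R^o)).
  rewrite kf; exact: fy.
apply/subspace_continuousP => h [y _ yh].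
apply/cvg_weak => f cf; have [t [psi [Apsi fE]]] := Agen f cf.
pose k : K := exist _ psi (mem_set Apsi).
have fg z : f (g (T z)) = t * T z k by rewrite Tg fE.
pose L := within (range T) (nbhs (T y)).
have FL : Filter L by exact: within_filter.
have ch : (fun h : Cp R K => h k : R^o) @ L --> (T y k : R^o).
  apply: cvg_trans (@continuous_Cp_eval R K k (T y)).
  by apply: cvg_app; exact: cvg_within.
have ck : (fun=> t : R^o) @ L --> (t : R^o) by exact: cvg_cst.
have cfg : (fun h : Cp R K => f (g h) : R^o) @ L --> (t * T y k : R^o).
  apply: cvg_trans (cvgM ck ch); apply: near_eq_cvg.
  apply: filterS (withinT _ _) => h' [z _ <-].
  by rewrite fg.
rewrite -yh fg; exact: cfg.
Qed.

End Converse.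

Theorem theorem3p5 (R : realType) (E F : tvsType R)
    (hausE : hausdorff_space E) (hausF : hausdorff_space F)
    (LEG_E : linearly_Eberlein_Grothendieck (weak E))
    (p : {linear E -> F}) (quot_p : linear_quotient_map p) :
  linearly_Eberlein_Grothendieck (weak F).
Proof.
have [A genA] := weak_LEG_dual_generator LEG_E.
have [B genB] := dual_generator_quotient quot_p genA.
exact: dual_generator_weak_LEG hausF genB.
Qed.
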